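(* Let $z$ and $c$ be parameters not depending on $q$, and let $n$ be a positive integer. Then \[ \sum_{\pi\in\mathcal{D}(n)}(-1)^{\#(\pi)-1}z^{l(\pi)+1-s(\pi)}c^{s(\pi)-1}\frac{(z/c)^{s(\pi)}-1}{(z/c)-1}=\sum_{\pi\in\mathcal{P}(n)}z^{\#(\pi)}c^{l(\pi)-1}\left(1-\frac1c\right)^{\nu_d(\pi)-1}. \]
   Context: For a partition $\pi$ of a positive integer: $s(\pi)$ is its smallest part, $l(\pi)$ its largest part, $\#(\pi)$ its number of parts, and $\nu_d(\pi)$ the number of distinct part sizes of $\pi$ (number of parts counted without multiplicity). $\mathcal{P}(n)$ is the set of all partitions of $n$ and $\mathcal{D}(n)$ the set of partitions of $n$ into distinct parts. *)

(* Defs.v *)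
From HB Require Import structures.
From mathcomp Require Import all_boot all_order all_algebra.
Set Implicit Arguments.
Unset Strict Implicit.
Unset Printing Implicit Defensive.

(* A partition of n is stored with its parts in weakly decreasing order, so
   that each multiset of parts is represented exactly once; the largest part
   is then the head of the list and the smallest part its last element. *)
Definition is_intpart (n : nat) (s : seq nat) : bool :=
  [&& sorted geq s, all (leq 1) s & sumn s == n].

Record intpart (n : nat) : Type :=
  IntPart { parts :> seq nat; partsP : is_intpart n parts }.

HB.instance Definition _ n := [isSub for @parts n].
HB.instance Definition _ n := [Countable of intpart n by <:].

(* Finiteness: a partition of n has at most n parts, each at most n. *)
Definition intpart_to_bseq n (p : intpart n) : n.-bseq 'I_n.+1 :=
  insub_bseq n [seq inord x | x <- p].

Definition intpart_of_bseq n (b : n.-bseq 'I_n.+1) : option (intpart n) :=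
  insub [seq val i | i <- b].

Lemma intpart_to_bseqK n : pcancel (@intpart_to_bseq n) (@intpart_of_bseq n).
Proof.
move=> p; rewrite /intpart_of_bseq /intpart_to_bseq.
have /and3P[_ pos /eqP sum_p] := partsP p.
have le_size (s : seq nat) : all (leq 1) s -> size s <= sumn s.
  by elim: s => //= x s IHs /andP[x_gt0 /IHs]; rewrite -add1n; apply: leq_add.
have le_part (s : seq nat) x : x \in s -> x <= sumn s.
  elim: s => //= y s IHs; rewrite inE => /predU1P[->|/IHs le_xs].
    exact: leq_addr.
  exact: leq_trans le_xs (leq_addl _ _).
have -> : [seq val i | i <- insub_bseq n [seq (inord x : 'I_n.+1) | x <- p]]
          = parts p.
  have size_p : size p <= n by rewrite -[leqRHS]sum_p le_size.
  rewrite /insub_bseq val_insubd size_map size_p -map_comp.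
  rewrite -[RHS]map_id; apply/eq_in_map => x /le_part; rewrite sum_p => le_xn.
  by rewrite /= inordK.
exact: valK.
Qed.

HB.instance Definition _ n : isFinite (intpart n) :=
  PCanIsFinite (@intpart_to_bseqK n).

Definition largest_part n (p : intpart n) : nat := head 0 p.
Definition smallest_part n (p : intpart n) : nat := last 0 p.
Definition num_parts n (p : intpart n) : nat := size p.
Definition num_distinct_parts n (p : intpart n) : nat := size (undup p).

Definition distinct_parts (n : nat) : {set intpart n} :=
  [set p : intpart n | uniq p].

(* Main.v *)
(* Compare coefficients of z^N.  On the left, expanding the geometric sum in
   z/c, the coefficient of c^k z^N is a signed count of the distinct partitions
   with largest part N + k and all parts greater than k, that is, the q^n
   coefficient of q^(N+k) (1 - q^(k+1)) ... (1 - q^(N+k-1)).  On the right it is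
   a weighted sum over the partitions of n with N parts; let h_N be the
   generating function in q of these sums.  Removing a part 1, or subtracting 1
   from every part if there is no part 1, shows that
   (1 - c q^(N+1)) h_(N+1) = q (1 - q^N) h_N, and the signed counts satisfy the
   same recurrence, which is the Pascal rule behind the q-binomial theorem. *)
Require Import Defs.
From HB Require Import structures.
From mathcomp Require Import all_boot all_order all_algebra.
From mathcomp Require Import zify ring.
Set Implicit Arguments.
Unset Strict Implicit.
Unset Printing Implicit Defensive.
Import GRing.Theory.
Local Open Scope ring_scope.

(** * Reindexing of sums over partitions, and facts on lists of parts *)

(** The bijection lives on bare lists, so [f] and [g] need to be mutually inverse only on lists that
    are partitions and satisfy the predicates. *)
Lemma reindex_intpart (V : nmodType) m n (f g : seq nat -> seq nat)
    (P Q : pred (seq nat)) (w : seq nat -> V) :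
    (forall s, is_intpart m s -> P s ->
       [/\ is_intpart n (f s), Q (f s) & g (f s) = s]) ->
    (forall t, is_intpart n t -> Q t ->
       [/\ is_intpart m (g t), P (g t) & f (g t) = t]) ->
  \sum_(t : intpart n | Q t) w t = \sum_(s : intpart m | P s) w (f s).
Proof.
move=> fP gP.
pose L k (R : pred (seq nat)) :=
  map (@parts k) [seq p <- enum {: intpart k} | R (parts p)].
have sumL k (R : pred (seq nat)) (v : seq nat -> V) :
    \sum_(p : intpart k | R p) v p = \sum_(s <- L k R) v s.
  by rewrite big_map big_filter big_enum_cond.
have memL k (R : pred (seq nat)) s : (s \in L k R) = is_intpart k s && R s.
  apply/mapP/andP => [[p] | [sP Rs]].
    by rewrite mem_filter => /andP[Rp _] ->; split=> //; exact: partsP.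
  by exists (IntPart sP) => //; rewrite mem_filter Rs mem_enum.
have uniqL k (R : pred (seq nat)) : uniq (L k R).
  rewrite map_inj_uniq => [|p q]; last exact: val_inj.
  exact/filter_uniq/enum_uniq.
rewrite (sumL n) (sumL m P (w \o f)) -(big_map f xpredT w).
apply: perm_big; apply: uniq_perm => //.
  rewrite map_inj_in_uniq // => s t; rewrite !memL.
  move=> /andP[/fP h /h[_ _ {2}<-]] /andP[/fP k /k[_ _ {2}<-]] ->.
  by [].
move=> t; rewrite memL; apply/andP/mapP => [[tP Qt]|[s]].
  by exists (g t); have [gm Pg fg] := gP t tP Qt; rewrite // memL gm Pg.
by rewrite memL => /andP[/fP h /h[nf Qf _]] ->.
Qed.

Lemma is_intpart_rcons1 n s : is_intpart n.+1 (rcons s 1%N) = is_intpart n s.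
Proof.
rewrite /is_intpart sumn_rcons all_rcons /= addn1 eqSS.
apply/and3P/and3P => -[sorted_s pos_s sum_s]; split => //.
  exact: (subseq_sorted (rev_trans leq_trans) (subseq_rcons s 1%N)).
case: s {sum_s} sorted_s pos_s => //= x s ss /andP[x1 pos_s].
rewrite rcons_path ss /=.
by have := mem_last x s; rewrite inE => /orP[/eqP->//|/(allP pos_s)].
Qed.

Lemma is_intpart_map_succn n s : all (leq 1) s ->
  is_intpart (n + size s) (map succn s) = is_intpart n s.
Proof.
move=> pos_s; rewrite /is_intpart pos_s sorted_map /= all_map.
have -> : sumn (map succn s) = (sumn s + size s)%N.
  by elim: s {pos_s} => //= x s ->; lia.
by rewrite eqn_add2r (eq_all (_ : _ =1 predT)) ?all_predT.
Qed.

Lemma map_predK s : all (leq 1) s -> map succn (map predn s) = s.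
Proof.
move=> pos_s; rewrite -map_comp -[RHS]map_id; apply/eq_in_map => x.
by move=> /(allP pos_s); case: x.
Qed.

Lemma geq_last (s : seq nat) x : sorted geq s -> x \in s -> (last 0 s <= x)%N.
Proof.
case/lastP: s => // s y ss.
rewrite last_rcons mem_rcons inE => /predU1P[->//|xs].
have : sorted leq (rev (rcons s y)) by rewrite rev_sorted.
rewrite rev_rcons /= => /(order_path_min leq_trans)/allP; apply.
by rewrite mem_rev.
Qed.

Lemma leq_head (s : seq nat) x : sorted geq s -> x \in s -> (x <= head 0 s)%N.
Proof.
case: s => //= y s /(order_path_min (rev_trans leq_trans))/allP ss.
by rewrite inE => /predU1P[->//|/ss].
Qed.

Lemma size_leq_sumn (s : seq nat) : all (leq 1) s -> (size s <= sumn s)%N.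
Proof. by elim: s => //= x s IHs /andP[x_gt0 /IHs]; lia. Qed.

(** * Weighted sums over partitions with a given number of parts *)

Section Weight.

Variables (F : fieldType) (c : F).
Hypothesis c_neq0 : c != 0.

(** The right-hand summand without its power of [z]. Truncated subtraction gives the empty list
    weight 1, so the two weight rules below ask for nonempty lists. *)
Definition weight (s : seq nat) : F :=
  c ^+ (head 0 s - 1) * (1 - 1 / c) ^+ (size (undup s) - 1).

(** The coefficient of [q^n] in the series h_N. *)
Definition weight_sum N n : F := \sum_(p : intpart n | size p == N) weight p.

Lemma weight_map_succn s : s != [::] -> all (leq 1) s ->
  weight (map succn s) = c * weight s.
Proof.
move=> s_n0 pos_s; rewrite /weight (undup_map_inj succn_inj) size_map mulrA.
congr (_ * _); case: s s_n0 pos_s => //= -[//|x] s _ _.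
by rewrite !subn1 /= exprS.
Qed.

(** A new part 1 adds a distinct size exactly when [s] has no part 1, which in a decreasing list
    shows at the last entry. *)
Lemma weight_rcons1 s : s != [::] -> sorted geq s -> all (leq 1) s ->
  weight (rcons s 1%N) =
  if last 0%N s == 1%N then weight s else (1 - 1 / c) * weight s.
Proof.
move=> s_n0 ss pos_s; rewrite /weight.
have -> : head 0%N (rcons s 1%N) = head 0%N s by case: s s_n0 {ss pos_s}.
have -> : size (undup (rcons s 1%N)) = ((1%N \notin s) + size (undup s))%N.
  rewrite -(perm_size (perm_undup _ : perm_eq (undup (1%N :: s)) _)).
    by rewrite /=; case: ifP.
  by move=> x; rewrite mem_rcons.
have -> : (1%N \in s) = (last 0%N s == 1%N).
  apply/idP/eqP => [/(geq_last ss)|<-].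
    suff : (0 < last 0 s)%N by lia.
    case: s s_n0 pos_s {ss} => //= x s _ /(@allP _ _ (x :: s)); apply.
    exact: mem_last.
  by case: s s_n0 {ss pos_s} => //= x s _; exact: mem_last.
have undup_gt0 : (0 < size (undup s))%N.
  case: s s_n0 {ss pos_s} => // x s _; rewrite -has_predT.
  by apply/hasP; exists x; rewrite // mem_undup mem_head.
case: eqP => _ //=.
by rewrite -(subnKC undup_gt0) addnA !addKn add1n exprS; ring.
Qed.

(** Subtracting 1 from each of the [N] parts keeps them positive and lowers the weight by one factor
    [c]. *)
Lemma weight_sum_no_ones N n : (0 < N)%N ->
  \sum_(p : intpart n | (size p == N) && (last 0%N p != 1%N)) weight p =
  if (N <= n)%N then c * weight_sum N (n - N) else 0.
Proof.
move=> N_gt0.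
have no_ones t : is_intpart n t -> (size t == N) && (last 0%N t != 1%N) ->
    all (leq 2) t.
  move=> /and3P[st pos_t _] /andP[/eqP szt last_t]; apply/allP => x xt.
  have := allP pos_t _ xt; have := geq_last st xt.
  suff : (0 < last 0 t)%N by lia.
  apply: (allP pos_t); case: t N_gt0 szt {st pos_t last_t xt} => [|y t] //=.
    by lia.
  by rewrite mem_last.
have shift t : is_intpart n t -> (size t == N) && (last 0%N t != 1%N) ->
    [/\ (N <= n)%N, is_intpart (n - N) (map predn t),
        size (map predn t) == N & map succn (map predn t) = t].
  move=> tP Pt; have t2 := no_ones t tP Pt; case/andP: Pt => /eqP szt _.
  case/and3P: (tP) => st pos_t /eqP sum_t.
  have le_Nn : (N <= n)%N.
    by rewrite -szt -sum_t; exact: size_leq_sumn.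
  split=> //; rewrite ?size_map ?szt ?map_predK //.
  rewrite -is_intpart_map_succn; last first.
    by rewrite all_map; apply: sub_all t2 => -[|[]].
  by rewrite size_map szt subnK // map_predK.
case: leqP => [le_Nn | lt_nN]; last first.
  rewrite big_pred0 // => p.
  by apply/negbTE/negP => /(shift _ (partsP p))[]; lia.
rewrite (@reindex_intpart _ (n - N)%N n (map succn) (map predn)
  (fun s => size s == N)
  (fun s => (size s == N) && (last 0%N s != 1%N)) weight).
- rewrite mulr_sumr; apply: eq_bigr => p /eqP szp; rewrite weight_map_succn //.
    by rewrite -size_eq0 szp -lt0n.
  by have /and3P[] := partsP p.
- move=> s sP /eqP szs; case/and3P: (sP) => ss pos_s _.
  split; last by rewrite mapK.
    by rewrite -(subnK le_Nn) -szs is_intpart_map_succn // szs.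
  rewrite size_map szs eqxx /=.
  case: s szs pos_s {sP ss} => [|x s] /=.
    by move=> szs; rewrite -szs in N_gt0.
  rewrite last_map eqSS -lt0n => _ /(@allP _ _ (x :: s)); apply.
  exact: mem_last.
- by move=> t tP /(shift _ tP)[].
Qed.

(** Coefficient of [q^(n+1)] in (1 - c q^(N+1)) h_(N+1) = q (1 - q^N) h_N, obtained by splitting on
    whether a part 1 occurs. *)
Lemma weight_sum_rec N n : (0 < N)%N ->
  weight_sum N.+1 n.+1 = weight_sum N n +
    (if (N <= n)%N
     then c * weight_sum N.+1 (n - N) - weight_sum N (n - N) else 0).
Proof.
move=> N_gt0; rewrite /weight_sum.
rewrite (bigID (fun p : intpart _ => last 0%N p == 1%N)) /=.
rewrite weight_sum_no_ones // subSS ltnS.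
rewrite (@reindex_intpart _ n n.+1 (rcons^~ 1%N) (take N) (fun s => size s == N)
  (fun s => (size s == N.+1) && (last 0%N s == 1%N)) weight).
(* The factor 1 - 1/c leaves a correction supported on partitions without 1; their sum carries a
   factor [c] that cancels 1/c. *)
- rewrite (eq_bigr (fun p : intpart n =>
    weight p + - c^-1 * (if last 0%N p != 1%N then weight p else 0))).
    rewrite big_split /= -mulr_sumr -big_mkcondr weight_sum_no_ones //= -addrA.
    congr (_ + _); case: leqP => _; rewrite ?mulr0 ?addr0 //.
    rewrite mulrA mulNr mulVf //.
    by rewrite mulN1r addrC.
  move=> p /eqP szp; have /and3P[sp pos_p _] := partsP p.
  rewrite weight_rcons1 //; last by rewrite -size_eq0 szp -lt0n.
  by case: eqP => _ /=; rewrite ?mulr0 ?addr0 //; ring.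
- move=> s sP /eqP szs.
  rewrite is_intpart_rcons1 size_rcons szs last_rcons !eqxx.
  by rewrite -cats1 take_size_cat.
- case/lastP => // t x.
  rewrite size_rcons last_rcons eqSS => tP /andP[/eqP szt /eqP x1].
  have -> : take N (rcons t x) = t by rewrite -cats1 -szt take_size_cat.
  by move: tP; rewrite x1 is_intpart_rcons1 szt; split.
Qed.

Lemma weight_sum1 n : weight_sum 1 n.+1 = c ^+ n.
Proof.
have nP : is_intpart n.+1 [:: n.+1] by rewrite /is_intpart /= addn0 eqxx.
rewrite /weight_sum (big_pred1 (IntPart nP)); last first.
  move=> p; apply/idP/eqP => [szp | -> //]; apply: val_inj => /=.
  have /and3P[_ _] := partsP p.
  by case: (parts p) szp => [|x []] //= _; rewrite addn0 => /eqP->.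
by rewrite /weight /= subn1 expr0 mulr1.
Qed.

Lemma weight_sum_n0 N : (0 < N)%N -> weight_sum N 0 = 0.
Proof.
move=> N_gt0; apply: big_pred0 => p; apply/negbTE/negP => /eqP szp.
have /and3P[_ + /eqP] := partsP p.
by case: (parts p) szp N_gt0 => [<-|[|x] s].
Qed.

(* The generating polynomial of the signed distinct partitions with largest
   part N + k and all parts greater than k. *)
Definition span_poly N k : {poly F} :=
  'X^(N + k) * \prod_(k.+1 <= j < N + k) (1 - 'X^j).

(** After the common factors are removed, this is (1 - X^(N+k+1)) - X^N (1 - X^(k+1)) = 1 - X^N. *)
Lemma span_polyS N k : (0 < N)%N ->
  span_poly N.+1 k.+1 - 'X^(N.+1) * span_poly N.+1 k =
  'X * (1 - 'X^N) * span_poly N k.+1.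
Proof.
move=> N_gt0; rewrite /span_poly.
have -> : \prod_(k.+2 <= j < N.+1 + k.+1) (1 - 'X^j) =
    \prod_(k.+2 <= j < N + k.+1) (1 - 'X^j) * (1 - 'X^(N + k.+1)) :> {poly F}.
  by rewrite addSn big_nat_recr //; lia.
have -> : \prod_(k.+1 <= j < N.+1 + k) (1 - 'X^j) =
    (1 - 'X^(k.+1)) * \prod_(k.+2 <= j < N + k.+1) (1 - 'X^j) :> {poly F}.
  by rewrite addSnnS big_ltn //; lia.
rewrite !addSnnS !exprD !exprS; ring.
Qed.

Lemma span_poly0 N : (0 < N)%N ->
  span_poly N.+1 0 = 'X * (1 - 'X^N) * span_poly N 0.
Proof.
move=> N_gt0; rewrite /span_poly !addn0 big_nat_recr //= exprS; ring.
Qed.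

(** Both sides obey the same recurrence, which lowers [n]. As X^(N+k) divides [span_poly N k], any
    bound [M] at least [n] will do, and this freedom lets the induction use bounds differing by
    one. *)
Lemma weight_sumE N n M : (0 < N)%N -> (n <= M)%N ->
  weight_sum N n = \sum_(k < M) c ^+ k * (span_poly N k)`_n.
Proof.
elim/ltn_ind: n N M => -[_|n IHn] N M N_gt0 le_nM.
  rewrite weight_sum_n0 // big1 // => k _.
  by rewrite /span_poly coefXnM ifT ?mulr0 //; lia.
case: M le_nM => // M le_nM.
case: N N_gt0 => [//|[_|N _]].
  (* For one part the product is empty and [span_poly] is X^(k+1), so only [k = n] contributes. *)
  rewrite weight_sum1 (bigD1 (Ordinal (le_nM : n < M.+1)%N)) //= big1 => [|k].
    rewrite addr0 /span_poly big_geq; last by lia.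
    by rewrite mulr1 add1n coefXn eqxx mulr1.
  rewrite -val_eqE /= => kn; rewrite /span_poly big_geq; last by lia.
  by rewrite mulr1 add1n coefXn eqSS eq_sym (negbTE kn) mulr0.
set N' := N.+1; have N_gt0 : (0 < N')%N by [].
rewrite weight_sum_rec //.
have coefE (k : nat) : (('X * (1 - 'X^N') * span_poly N' k) : {poly F})`_n.+1 =
    (span_poly N' k)`_n -
    (if (N' <= n)%N then (span_poly N' k)`_(n - N') else 0).
  rewrite -mulrA coefXM /= mulrBl mul1r coefB (coefXnM _ (span_poly N' k)).
  by case: leqP.
have shiftE (k : nat) : ('X^(N'.+1) * span_poly N'.+1 k)`_n.+1 =
    if (N' <= n)%N then (span_poly N'.+1 k)`_(n - N') else 0.
  by rewrite (coefXnM _ (span_poly N'.+1 k)) ltnS subSS; case: leqP.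
(* The recurrence in polynomial form. The second sum has one term fewer because its factor [c]
   shifts [k] by one. *)
transitivity (
  \sum_(k < M.+1) c ^+ k * ('X * (1 - 'X^N') * span_poly N' k)`_n.+1 +
  c * \sum_(k < M) c ^+ k * ('X^(N'.+1) * span_poly N'.+1 k)`_n.+1).
  rewrite (IHn n _ N' M.+1) //; last by lia.
  under [X in _ = X + _]eq_bigr do rewrite coefE mulrBr.
  under [X in _ = _ + _ * X]eq_bigr do rewrite shiftE.
  rewrite sumrB -addrA; congr (_ + _).
  case: (leqP N' n) => [le_Nn|_]; last first.
    by rewrite !big1 ?mulr0 ?oppr0 ?addr0 // => k _; rewrite mulr0.
  by rewrite addrC (IHn _ _ N'.+1 M) ?(IHn _ _ N' M.+1) //; lia.
(* The term [k = 0] is [span_poly0]; the others match one by one through [span_polyS]. *)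
rewrite !big_ord_recl -span_poly0 // -addrA; congr (_ + _).
rewrite mulr_sumr -big_split; apply: eq_bigr => k _ /=.
rewrite /bump leq0n add1n -span_polyS // coefB exprS; ring.
Qed.

End Weight.

(** * Signed sums over partitions into distinct parts *)

(** Deleting the largest part [b.+1] leaves distinct parts in the interval from [a.+1] to [b]. *)
Lemma signed_sum_head (R : pzRingType) a b n : (a <= b)%N ->
  \sum_(p : intpart n | [&& uniq p, all (ltn a) p & head 0%N p == b.+1])
    (-1) ^+ (size p - 1) =
  if (b.+1 <= n)%N then
    \sum_(p : intpart (n - b.+1) | uniq p && all (fun x => a < x <= b)%N p)
      (-1) ^+ size p
  else 0 :> R.
Proof.
move=> le_ab; case: (ltnP b n) => [lt_bn | le_nb]; last first.
  apply: big_pred0 => p; apply/negbTE/negP => /and3P[_ _].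
  have /and3P[_ _ /eqP] := partsP p.
  by case: (parts p) => //= x s + /eqP; lia.
rewrite (@reindex_intpart _ (n - b.+1)%N n (cons b.+1) behead
  (fun s => uniq s && all (fun x => a < x <= b)%N s)
  (fun s => [&& uniq s, all (ltn a) s & head 0%N s == b.+1])
  (fun s => (-1) ^+ (size s - 1))).
- by apply: eq_bigr => p _; rewrite subn1.
- move=> s /and3P[ss pos_s /eqP sum_s] /andP[uniq_s /allP s_ab]; split=> //.
    rewrite /is_intpart /= pos_s sum_s subnKC // eqxx !andbT.
    rewrite path_sortedE ?ss ?andbT; last exact: rev_trans leq_trans.
    by apply/allP => x /s_ab; lia.
  rewrite /= uniq_s eqxx !andbT; apply/andP; split.
    by apply/negP => /s_ab; lia.
  by apply/andP; split; [lia | apply/allP => x /s_ab /=; lia].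
- case=> [|x s] tP /and3P[] //= /andP[x_s uniq_s] /andP[_ s_a] /eqP x_b.
  subst x.
  move: tP => /and3P[/= + pos_s /eqP sum_s].
  rewrite path_sortedE; last exact: rev_trans leq_trans.
  move=> /andP[/allP s_b ss]; split=> //.
    by rewrite /is_intpart ss pos_s -sum_s addKn eqxx.
  rewrite uniq_s; apply/allP => x xs /=.
  have /= := allP s_a x xs; have /= := s_b x xs.
  suff : x != b.+1 by lia.
  by apply: contraNneq x_s => <-.
Qed.

(** Expanding the product, the choice of -X^j in the factor of index j makes j a part with sign -1.
    The induction peels off the top factor. *)
Lemma signed_sum_interval (R : nzRingType) a d n :
  \sum_(p : intpart n | uniq p && all (fun x => a < x <= a + d)%N p)
    (-1) ^+ size p =
  (\prod_(a.+1 <= j < (a + d).+1) (1 - 'X^j : {poly R}))`_n.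
Proof.
elim: d n => [|d IHd] n.
  rewrite addn0 big_geq // coef1.
  case: n => [|n].
    have nilP : is_intpart 0 [::] by [].
    rewrite (big_pred1 (IntPart nilP)) // => p; apply/idP/eqP => [_|->//].
    apply: val_inj => /=; have /and3P[_ + /eqP] := partsP p.
    by case: (parts p) => // -[].
  rewrite big_pred0 // => p; apply/negbTE/negP => /andP[_].
  by have /and3P[_ _] := partsP p; case: (parts p) => //= x s _; lia.
rewrite addnS big_nat_recr /=; last by lia.
rewrite mulrBr mulr1 coefB coefMXn -!IHd.
(* The top value can only occur as the head; the default 0 puts the empty partition among those
   without it. *)
rewrite (bigID (fun p : intpart n => head 0%N p == (a + d).+1)) /= addrC.
congr (_ + _).
  apply: eq_bigl => p; have /and3P[sp _ _] := partsP p.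
  rewrite -andbA; congr (_ && _).
  apply/andP/allP => [[/allP p_ad hp] x xp|p_ad].
    have := p_ad x xp; have := leq_head sp xp.
    suff : (head 0 p <= (a + d).+1)%N by lia.
    by case: (parts p) p_ad {hp sp xp} => //= y s /(_ y (mem_head _ _)); lia.
  split; first by apply/allP => x /p_ad; lia.
  by case: (parts p) p_ad {sp} => //= y s /(_ y (mem_head _ _)); lia.
transitivity (- \sum_(p : intpart n |
    [&& uniq p, all (ltn a) p & head 0%N p == (a + d).+1])
      (-1) ^+ (size p - 1) : R).
  rewrite -sumrN; apply: eq_big => p.
    have /and3P[sp _ _] := partsP p; rewrite -andbA; congr (_ && _).
    apply/andP/andP => -[/allP p_a /eqP hp]; rewrite hp eqxx; split=> //.
      by apply/allP => x /p_a /= /andP[].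
    apply/allP => x xp; have := leq_head sp xp; have := p_a x xp => /=; lia.
  case/andP=> _ /eqP; case: (parts p) => //= x s _.
  by rewrite subn1 exprS mulN1r.
by rewrite signed_sum_head ?leq_addr // [in RHS]ltnNge if_neg.
Qed.

Lemma coef_span_poly (F : fieldType) N k n : 
  (span_poly F N.+1 k)`_n =
  \sum_(p : intpart n | [&& uniq p, all (ltn k) p & head 0%N p == (N + k).+1])
    (-1) ^+ (size p - 1).
Proof.
rewrite (@signed_sum_head F k (N + k) n) ?leq_addl //.
rewrite /span_poly coefXnM ltnNge if_neg addSn; case: ifP => // _.
by rewrite [(N + k)%N]addnC -signed_sum_interval.
Qed.

(** * Geometric expansion and comparison of coefficients *)

Lemma geometric_sum (F : fieldType) (z c : F) s l :
  c != 0 -> z != c -> (0 < s <= l)%N ->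
  z ^+ (l + 1 - s) * c ^+ (s - 1) * (((z / c) ^+ s - 1) / (z / c - 1)) =
  \sum_(k < s) z ^+ (l - k) * c ^+ k.
Proof.
move=> c_neq0 zc /andP[s_gt0 le_sl].
have zc1 : z / c - 1 != 0.
  by rewrite subr_eq0; apply: contra zc => /eqP/(divr1_eq)->.
rewrite subrX1 [X in _ * (X / _)]mulrC mulfK // mulr_sumr.
(* Reversing the index makes [k] the exponent of [c]. *)
rewrite (reindex_inj rev_ord_inj) /=.
apply: eq_bigr => k _; have lt_ks := ltn_ord k.
rewrite expr_div_n.
have -> : (l - k = (l + 1 - s) + (s - k.+1))%N by lia.
have -> : (s - 1 = (s - k.+1) + k)%N by lia.
rewrite !exprD; field.
by rewrite expf_neq0.
Qed.

Theorem theorem2p3 (F : fieldType) (z c : F) (n : nat)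
    (hc : c != 0) (hzc : z != c) (hn : (0 < n)%N) :
  \sum_(p in distinct_parts n)
     (-1) ^+ (num_parts p - 1)
     * z ^+ (largest_part p + 1 - smallest_part p)
     * c ^+ (smallest_part p - 1)
     * (((z / c) ^+ smallest_part p - 1) / (z / c - 1))
  = \sum_(p : intpart n)
     z ^+ num_parts p
     * c ^+ (largest_part p - 1)
     * (1 - 1 / c) ^+ (num_distinct_parts p - 1).
Proof.
case: n hn => // m _; set n := m.+1.
rewrite /num_parts /largest_part /smallest_part /num_distinct_parts.
have nonempty (p : intpart n) : (0 < size p)%N.
  by have /and3P[_ _] := partsP p; case: (parts p).
have size_le (p : intpart n) : (size p <= n)%N.
  by have /and3P[_ /size_leq_sumn + /eqP sum_p] := partsP p; rewrite sum_p.
have head_le (p : intpart n) : (head 0 p <= n)%N.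
  by have /and3P[_ _ /eqP] := partsP p; case: (parts p) => //= x s; lia.
have last_mem (p : intpart n) : last 0%N p \in parts p.
  by case: (parts p) (nonempty p) => //= x s _; exact: mem_last.
have last_gt0 (p : intpart n) : (0 < last 0%N p)%N.
  by have /and3P[_ pos_p _] := partsP p; exact: (allP pos_p).
have last_le_head (p : intpart n) : (last 0 p <= head 0 p)%N.
  by have /and3P[sp _ _] := partsP p; exact: leq_head.
(* In this common form [N.+1] is the exponent of [z] and [k] that of [c]. The right side is matched
   first, by grouping partitions by size. *)
transitivity (\sum_(N < n) \sum_(k < n) \sum_(p : intpart n |
   [&& uniq p, all (ltn k) p & head 0%N p == (N + k).+1])
     z ^+ N.+1 * c ^+ k * (-1) ^+ (size p - 1)); last first.
  rewrite [RHS](partition_big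
    (fun p : intpart n => inord (size p).-1 : 'I_n) xpredT) //=.
  apply: eq_bigr => N _.
  transitivity (z ^+ N.+1 * weight_sum c N.+1 n).
    rewrite (@weight_sumE F c hc N.+1 n n) // mulr_sumr; apply: eq_bigr => k _.
    by rewrite coef_span_poly !mulr_sumr; apply: eq_bigr => p _; rewrite mulrA.
  rewrite mulr_sumr; apply: eq_big => p.
    have := nonempty p; have := size_le p; rewrite -val_eqE /= => le_pn p_gt0.
    by rewrite inordK //; lia.
  by move=> /eqP ->; rewrite mulrA.
rewrite exchange_big /=.
(* With [p] and [k] outside, the head condition leaves at most one [N]. *)
transitivity (\sum_(k < n) \sum_(p : intpart n | uniq p)
    \sum_(N < n | all (ltn k) p && (head 0%N p == (N + k).+1))
      z ^+ N.+1 * c ^+ k * (-1) ^+ (size p - 1)); last first.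
  apply: eq_bigr => k _.
  rewrite [RHS](exchange_big_dep (fun p : intpart n => uniq p)) /=.
    by apply: eq_bigr => p ->.
  by move=> N p _ /and3P[].
rewrite exchange_big /=; apply: eq_big => [p | p uniq_p]; first by rewrite inE.
rewrite -(mulrA (_ ^+ _) (z ^+ _)) -(mulrA (_ ^+ _)) geometric_sum //;
  last by rewrite last_gt0 last_le_head.
rewrite (big_ord_widen n (fun k => z ^+ (head 0%N p - k) * c ^+ k)); last first.
  exact: leq_trans (last_le_head p) (head_le p).
rewrite mulr_sumr big_mkcond; apply: eq_bigr => k _.
(* The parts all exceed [k] exactly when the smallest does, which is the range of the geometric
   sum. *)
have -> : all (ltn k) p = (k < last 0 p)%N.
  apply/allP/idP => [/(_ _ (last_mem p)) // | lt_k x xp].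
  apply: leq_trans lt_k _.
  by have /and3P[sp _ _] := partsP p; exact: geq_last.
case: ltnP => [lt_k | _]; last by rewrite big_pred0.
have ltN : (head 0 p - k.+1 < n)%N.
  by have := head_le p; have := last_gt0 p; have := last_le_head p; lia.
rewrite (big_pred1 (Ordinal ltN)) => [|N].
  rewrite mulrC; congr (_ ^+ _ * _ * _) => /=.
  by have := last_le_head p; lia.
by rewrite /= -val_eqE /=; have := last_le_head p; lia.
Qed.
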